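(* Let $E=\ell_1$, let $B$ be its closed unit ball, $S_{\ell_1}$ its unit sphere, and let $B_w$ be $B$ endowed with the weak topology. Then there are a countable subset $A$ of $S_{\ell_1}$ and a family $\mathcal{U}=\{U_a : a\in A\}$ of weakly open subsets of the unit ball $B$ (i.e. open subsets of $B_w$) such that: (1) $a\in U_a$ for every $a\in A$; (2) $\mathrm{dist}(U_a,U_b)\ge 1/5$ for all distinct $a,b\in A$; (3) $0$ is the unique cluster point of $A$ (in the weak topology); (4) $|\{a\in A : C\cap U_a\neq\emptyset\}|<\infty$ for every weakly compact subset $C$ of $B$; (5) $\overline{A}^{\,w}=A\cup\{0\}$ and every weakly compact subset of $\overline{A}^{\,w}$ is finite; (6) $A$ contains a sequence which is equivalent to the unit basis of $\ell_1$; (7) the set $A$ does not have a non-trivial weakly fundamental subsequence, that is, there is no non-trivial sequence of elements of $A$ which is weakly Cauchy; (8) the countable space $\overline{A}^{\,w}$ (with the weak topology) and $B_w$ are not Ascoli spaces.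
   Context: $\overline{A}^{\,w}$ denotes the closure of $A$ in the weak topology of $\ell_1$. The distance in (2) is the norm distance, $\mathrm{dist}(U,V)=\inf\{\|x-y\| : x\in U, y\in V\}$. A point $z$ is a cluster point of a set $A$ if every neighborhood of $z$ contains points of $A$ different from $z$. A sequence $(x_i)_{i\in\mathbb{N}}$ is trivial if there is $n\in\mathbb{N}$ such that $x_i=x_n$ for all $i>n$; weakly fundamental means Cauchy in the weak topology. A sequence $(x_n)$ of norm-one vectors is equivalent to the unit basis of $\ell_1$ if for some $\theta>0$ one has $\|\sum_{i=1}^n c_i x_i\|\ge\theta\sum_{i=1}^n|c_i|$ for all $n$ and all scalars $c_i$. For a topological space $Z$, $C_k(Z)$ denotes the space of all continuous functions $Z\to\mathbb{R}$ endowed with the compact-open topology. A subset $\mathcal{K}\subset C_k(Z)$ is evenly continuous if the evaluation map $(z,f)\mapsto f(z)$ restricted to $Z\times\mathcal{K}$ is jointly continuous, i.e. for every $z\in Z$, every $f\in\mathcal{K}$ and every neighborhood $O$ of $f(z)$ in $\mathbb{R}$ there are neighborhoods $U_f\subset\mathcal{K}$ of $f$ (in $\mathcal{K}$) and $O_z\subset Z$ of $z$ such that $g(y)\in O$ for all $g\in U_f$, $y\in O_z$. A Tychonoff space $Z$ is called an Ascoli space if every compact subset of $C_k(Z)$ is evenly continuous. *)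

(* Defs.v *)
From HB Require Import structures.
From mathcomp Require Import all_boot all_order all_algebra.
From mathcomp Require Import all_classical all_reals all_analysis.

Set Implicit Arguments.
Unset Strict Implicit.
Unset Printing Implicit Defensive.

Import Order.TTheory GRing.Theory Num.Def Num.Theory.
Import numFieldNormedType.Exports.

Local Open Scope classical_set_scope.
Local Open Scope ring_scope.

Definition abs_summable (R : realType) : {pred nat -> R^o} :=
  fun x => `[< cvgn (series (fun n => `|x n|)) >].

Record ell1 (R : realType) := Ell1 {
  ell1_val :> nat -> R^o ;
  _ : ell1_val \in @abs_summable R }.

Section ell1_normedModType.
Variable R : realType.
Implicit Types x y : nat -> R^o.

Let summE x : (x \in @abs_summable R) = `[< cvgn (series (fun n => `|x n|)) >].
Proof. by []. Qed.

Let normed_seriesZ k x :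
  series (fun n => `|(k *: x) n|) = `|k| *: series (fun n => `|x n|).
Proof.
apply/funext => n; rewrite /series /=.
rewrite [RHS]/GRing.scale /= [RHS]/GRing.scale /= mulr_sumr.
by apply: eq_bigr => i _; rewrite -normrM.
Qed.

Let abs_summable_submod : submod_closed (@abs_summable R).
Proof.
split=> [|k x y]; rewrite !summE.
  apply/asboolP; rewrite (_ : series _ = fun=> 0).
    exact: is_cvg_cst.
  apply/funext => n; rewrite /series /=.
  by under eq_bigr do rewrite normr0; rewrite big1.
move=> /asboolP cx /asboolP cy; apply/asboolP.
apply: (@series_le_cvg R _ (fun n => `|k| * `|x n| + `|y n|)) => //.
- by move=> n; rewrite -normrM; exact: ler_normD.
rewrite (_ : series _ = `|k| *: series (fun n => `|x n|) +
                          series (fun n => `|y n|)).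
  by apply: is_cvgD => //; apply: is_cvgZl_tmp.
apply/funext => n; rewrite -normed_seriesZ /series /=.
rewrite [RHS]/GRing.add /= -big_split /=.
by apply: eq_bigr => i _; rewrite normrM.
Qed.

HB.instance Definition _ := [isSub for @ell1_val R].
HB.instance Definition _ := [Choice of ell1 R by <:].
HB.instance Definition _ :=
  GRing.isSubmodClosed.Build R _ (@abs_summable R) abs_summable_submod.
HB.instance Definition _ := [SubChoice_isSubLmodule of ell1 R by <:].

Lemma ell1_cvg (x : ell1 R) : cvgn (series (fun n => `|x n|)).
Proof. exact/asboolP/(valP x). Qed.

Definition ell1_norm (x : ell1 R) : R := limn (series (fun n => `|x n|)).

Lemma normr_le_ell1_norm (x : ell1 R) n : `|x n| <= ell1_norm x.
Proof.
apply: (@le_trans _ _ (series (fun n => `|x n|) n.+1)).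
  by rewrite /series /= big_nat_recr//= lerDr sumr_ge0.
apply: nondecreasing_cvgn_le; last exact: ell1_cvg.
by apply/nondecreasing_seqP => m; rewrite /series /= big_nat_recr//= lerDl.
Qed.

Let ell1_normD (x y : ell1 R) : ell1_norm (x + y) <= ell1_norm x + ell1_norm y.
Proof.
rewrite /ell1_norm -limD; [|exact: ell1_cvg..].
apply: ler_lim; [exact: ell1_cvg|apply: is_cvgD; exact: ell1_cvg|].
apply: nearW => n; rewrite [leRHS]/GRing.add /= /series /= -big_split /=.
by apply: ler_sum => i _; exact: ler_normD.
Qed.

Let ell1_normZ k (x : ell1 R) : ell1_norm (k *: x) = `|k| * ell1_norm x.
Proof.
rewrite /ell1_norm -[RHS](@limZl_tmp _ R^o _ _ _ `|k| _ (@ell1_cvg x)).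
by rewrite -normed_seriesZ.
Qed.

Let ell1_norm_eq0 (x : ell1 R) : ell1_norm x = 0 -> x = 0.
Proof.
move=> x0; apply/val_inj/funext => n; apply/eqP.
by rewrite -normr_le0 -x0; exact: normr_le_ell1_norm.
Qed.

HB.instance Definition _ :=
  Lmodule_isNormed.Build R (ell1 R) ell1_normD ell1_normZ ell1_norm_eq0.

End ell1_normedModType.

Section weak_topology.
Variables (R : realType) (V : normedModType R).

Definition dual := {f : {linear V -> R^o} | continuous f}.

(** The carrier of [weak V] is [V] itself: a set [A : set V] is viewed in the
    weak topology by writing [A : set (weak V)]. *)
Definition weak : Type := V.

Definition weak_topology_def :=
  sup_topology (fun f : dual =>
    Uniform.class (initial_topology (sval f : V -> R^o))).

(** Besides the topology, this provides the weak uniformity, for which the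
    library's [cauchy] means weakly Cauchy. *)
HB.instance Definition _ := Uniform.copy weak weak_topology_def.

Lemma dual_weak_continuous (f : dual) : continuous (sval f : weak -> R^o).
Proof.
move=> x; have /cvg_sup/(_ f) : nbhs (x : weak) --> (x : weak) by exact: cvg_id.
by move=> xf A fA; apply: xf; apply: initial_continuous fA.
Qed.

End weak_topology.

Definition tychonoff_space (Z : topologicalType) :=
  completely_regular_space Z /\ hausdorff_space Z.

Section ascoli.
Variables (R : realType) (Z : topologicalType).

(* [continuousType Z R] with the compact-open topology is C_k(Z). *)
Import ArrowAsCompactOpen.

Definition evenly_continuous (K : set (continuousType Z R)) :=
  {within K `*` [set: Z], continuous (@eval Z R)}.

Definition ascoli_space :=
  tychonoff_space Z /\
  forall K : set (continuousType Z R), compact K -> evenly_continuous K.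

End ascoli.
Arguments ascoli_space : clear implicits.

Section weak_ell1_tychonoff.
Variable R : realType.

Let subset_completely_regular (X : uniformType) (A : set X) :
  completely_regular_space A.
Proof. exact: (@uniform_completely_regular R). Qed.

Let coord n (x : ell1 R) : R^o := x n.

Let coord_linear n : linear (coord n).
Proof. by []. Qed.

HB.instance Definition _ n :=
  GRing.isLinear.Build R (ell1 R) R^o _ (coord n) (coord_linear n).

Let coord_continuous n : continuous (coord n).
Proof.
apply: bounded_linear_continuous; apply/ex_bound; exists 1.
apply/nbhs_ballP; exists 1 => //= x; rewrite -ball_normE /= sub0r normrN => x1.
exact: le_trans (normr_le_ell1_norm x n) (ltW x1).
Qed.

Let coord_weak_continuous n : continuous (coord n : weak (ell1 R) -> R^o).
Proof.
pose f : dual (ell1 R) :=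
  exist _ (coord n : {linear _ -> _}) (@coord_continuous n).
exact: (@dual_weak_continuous _ _ f).
Qed.

Lemma subset_weak_ell1_tychonoff (A : set (weak (ell1 R))) :
  tychonoff_space A.
Proof.
split; first exact: subset_completely_regular.
move=> p q pq; apply/val_inj/val_inj/funext => n.
pose g : A -> R^o := coord n \o set_val.
have gc : continuous g.
  move=> x; apply: (@continuous_comp _ (weak (ell1 R)) _ set_val (coord n)).
    exact: initial_continuous.
  exact: coord_weak_continuous.
rewrite -[LHS]/(g p) -[RHS]/(g q).
apply: (@norm_hausdorff R R^o) => U V /gc gU /gc gV.
by have [x [Ux Vx]] := pq _ _ gU gV; exists (g x).
Qed.

End weak_ell1_tychonoff.

Section normed_notions.
Variables (R : realType) (V : normedModType R).

Definition set_dist (A B : set V) : \bar R :=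
  ereal_inf [set `|x - y|%:E | x in A & y in B].

Definition equiv_ell1_basis (x : nat -> V) :=
  (forall n, `|x n| = 1) /\
  exists2 theta : R, 0 < theta & forall n (c : nat -> R),
    theta * \sum_(i < n) `|c i| <= `|\sum_(i < n) c i *: x i|.

End normed_notions.

Definition trivial_seq (T : Type) (x : nat -> T) :=
  exists n, forall i, (n < i)%N -> x i = x n.

(* Main.v *)
From HB Require Import structures.
Require Import Defs.
From mathcomp Require Import all_boot all_order all_algebra.
From mathcomp Require Import all_classical all_reals all_analysis.
From mathcomp Require Import lra zify.

Set Implicit Arguments.
Unset Strict Implicit.
Unset Printing Implicit Defensive.

Import Order.TTheory GRing.Theory Num.Def Num.Theory.
Import numFieldNormedType.Exports.

Local Open Scope classical_set_scope.
Local Open Scope ring_scope.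

(** Take for [A] the vectors [(e_m - e_n) / 2] with [m < n], and for the
    neighbourhood of such a vector the slice of [B] where the coordinate [m]
    exceeds 2/5 and the coordinate [n] is below -2/5.

    Two such slices are far apart because a point of a slice has mass above 4/5
    on its two peaks, hence all its other coordinates are below 1/5
    ([peaks_other], [peaks_dist]).

    The origin is a weak cluster point of [A]: a functional takes bounded values
    on the [e_n], so these values converge along a free ultrafilter on nat, and
    [(e_m - e_n) / 2] tends weakly to 0 when [m], then [n], go to infinity along
    it ([half_diff_cluster0]). There is no other cluster point: some
    weak neighbourhood of [z] is disjoint from [A] if the coordinates of [z] do
    not sum up to 0, and otherwise [z], if nonzero, has two nonzero coordinates,
    and at most one element of [A] is nonzero at both ([half_diff_isolated]).

    For weak compactness and weak Cauchy sequences, an infinite family of pairs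
    [m < n] contains pairs [(s i, t i)] with [t] increasing and no [s i] among
    the [t j] ([sparse_pairs]). If a weakly compact subset of [B] met infinitely
    many slices, sum the coordinates over the set of all [t i]: the sum over
    this set past any [K] is below -1/5 at points of infinitely many slices,
    hence at most -1/5 at a cluster point of them, whereas it tends to 0 with
    [K] at each single point ([weak_compact_peaks]). Summing over every other
    [t i] gives a functional that takes two values infinitely often, so that a
    weakly Cauchy sequence in [A] only involves finitely many pairs; it is then
    eventually constant because its coordinates are ([weak_cauchy_half_diff]).

    Finally, on any subset of [B] containing [A] and 0, bump functions
    supported in the slices tend to 0 in the compact-open topology, since a
    compact set meets finitely many slices. Together with 0 they form a compact
    set of functions, which is not evenly continuous at the origin because
    every bump has the value 1 at a point of [A] ([not_ascoli_half_diff]). *)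

(** * Bounded weights as functionals on the space of summable sequences *)

Section pairing.
Variable R : realType.
Implicit Types (w v : nat -> R) (x y : ell1 R) (M : R).

(** The pairing of a weight sequence with a summable sequence; the
    series may diverge when the weights are unbounded. *)
Definition pairing w x : R := limn (series (fun n => w n * x n)).

Lemma normed_pairing_cvg w M x : (forall n, `|w n| <= M) ->
  cvgn [normed series (fun n => w n * x n)].
Proof.
move=> wM; apply: (@series_le_cvg R _ (M *: (fun n => `|x n|))).
- by move=> n; exact: normr_ge0.
- by move=> n; rewrite mulr_ge0 ?(le_trans _ (wM n)).
- by move=> n /=; rewrite normrM ler_wpM2r.
- by apply: is_cvg_seriesZ; exact: ell1_cvg.
Qed.

Lemma pairing_cvg w M x : (forall n, `|w n| <= M) ->
  cvgn (series (fun n => w n * x n)).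
Proof.
by move=> wM; apply: (@normed_cvg R R^o); exact: normed_pairing_cvg wM.
Qed.

Lemma pairing_le w M x : (forall n, `|w n| <= M) ->
  `|pairing w x| <= M * `|x|.
Proof.
move=> wM.
have /le_trans := @lim_series_norm R R^o _ (@normed_pairing_cvg w M x wM).
apply.
rewrite -[leRHS](@lim_seriesZ R _ M (@ell1_cvg R x)).
apply: lim_series_le; first exact: normed_pairing_cvg wM.
  by apply: is_cvg_seriesZ; exact: ell1_cvg.
by move=> n /=; rewrite normrM ler_wpM2r.
Qed.

Lemma pairing_linear w M k x y : (forall n, `|w n| <= M) ->
  pairing w (k *: x + y) = k * pairing w x + pairing w y.
Proof.
move=> wM; have cx := @pairing_cvg w M x wM; have cy := @pairing_cvg w M y wM.
have kE := @lim_seriesZ R _ k cx; rewrite [RHS]/GRing.scale/= in kE.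
rewrite /pairing -kE -(lim_seriesD (is_cvg_seriesZ cx) cy).
congr (limn (series _)).
by apply/funext => n; rewrite [in RHS]/GRing.add/= [in LHS]mulrDr mulrCA.
Qed.

Lemma pairingDl w v M x : (forall n, `|w n| <= M) -> (forall n, `|v n| <= M) ->
  pairing (fun n => w n + v n) x = pairing w x + pairing v x.
Proof.
move=> wM vM; have cw := @pairing_cvg w M x wM.
have cv := @pairing_cvg v M x vM.
rewrite /pairing -(lim_seriesD cw cv); congr (limn (series _)).
by apply/funext => n; rewrite [in RHS]/GRing.add/= mulrDl.
Qed.

Lemma pairing_eventually0 w x K : (forall n, (K <= n)%N -> w n * x n = 0) ->
  pairing w x = \sum_(i < K) w i * x i.
Proof.
move=> wx0; apply: norm_lim_near_cst; exists K => // n /= Kn.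
rewrite /series /= (@big_cat_nat _ _ _ K)//= [X in _ + X]big_nat.
rewrite [X in _ + X]big1 => [|i /andP[Ki _]]; last exact: wx0.
by rewrite addr0 big_mkord.
Qed.

(** Bounded weights act as weakly continuous functionals. *)
Lemma pairing_dual w M : (forall n, `|w n| <= M) ->
  exists f : dual (ell1 R), forall x, sval f x = pairing w x.
Proof.
move=> wM.
have lin : linear (pairing w : ell1 R -> R^o).
  by move=> k x y; exact: pairing_linear wM.
pose f : {linear ell1 R -> R^o} := HB.pack (pairing w : ell1 R -> R^o)
  (GRing.isLinear.Build R (ell1 R) R^o _ (pairing w) lin).
have fc : continuous f.
  apply: bounded_linear_continuous; apply/ex_bound; exists M.
  apply/nbhs_ballP; exists 1 => //= x.
  rewrite -ball_normE /= sub0r normrN => x1.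
  apply: (le_trans (pairing_le x wM)); rewrite ler_piMr ?(ltW x1)//.
  exact: le_trans (wM 0).
by exists (exist _ f fc).
Qed.

Lemma pairing_weak_continuous w M : (forall n, `|w n| <= M) ->
  continuous (pairing w : weak (ell1 R) -> R).
Proof.
move=> /pairing_dual[f fE]; rewrite (_ : pairing w = sval f); last first.
  by apply/funext => x; rewrite fE.
exact: (@dual_weak_continuous _ _ f).
Qed.

End pairing.

Section more_pairing.
Variable R : realType.
Implicit Types (w : nat -> R) (x : ell1 R) (M : R) (D : pred nat).

Lemma pairing_indicator_bound D n : `|(D n)%:R : R| <= 1.
Proof. by case: (D n); rewrite ?normr1 ?normr0. Qed.

Lemma pairing_add_coord w M c j x : (forall n, `|w n| <= M) ->
  pairing (fun n => w n + c * (n == j)%:R) x = pairing w x + c * x j.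
Proof.
move=> wM; rewrite (@pairingDl _ _ _ (M + `|c|)).
- congr (_ + _); rewrite (@pairing_eventually0 _ _ _ j.+1).
    rewrite big_ord_recr /= eqxx mulr1 big1 ?add0r// => i _.
    by rewrite (ltn_eqF (ltn_ord i)) mulr0 mul0r.
  by move=> n jn; rewrite gtn_eqF// mulr0 mul0r.
- by move=> n; rewrite (le_trans (wM n))// lerDl.
- move=> n; have M0 := le_trans (normr_ge0 _) (wM 0).
  by case: (n == j); rewrite ?mulr1 ?mulr0 ?normr0 ?addr_ge0// lerDr.
Qed.

Lemma pairing_coord j x : pairing (fun n => (n == j)%:R) x = x j.
Proof.
have -> : (fun n => (n == j)%:R : R) = (fun n => 0 + 1 * (n == j)%:R).
  by apply/funext => n; rewrite add0r mul1r.
rewrite (@pairing_add_coord _ 0)=> [|n]; last by rewrite normr0.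
by rewrite (@pairing_eventually0 _ _ _ 0) ?big_ord0 ?add0r ?mul1r// => n _;
  rewrite mul0r.
Qed.

Lemma coord_weak_continuous j :
  continuous ((fun x : ell1 R => x j) : weak (ell1 R) -> R).
Proof.
have -> : (fun x : ell1 R => x j) = (pairing (fun n => (n == j)%:R)).
  by apply/funext => x; rewrite pairing_coord.
exact: (@pairing_weak_continuous _ _ 1 (pairing_indicator_bound (pred1 j))).
Qed.

(** Restricting a set of indices to its far tail makes the partial sum small
    at each single point. *)
Lemma pairing_tail D x (e : R) : 0 < e -> exists K,
  `|pairing (fun n => (D n && (K <= n)%N)%:R) x| < e.
Proof.
move=> e0.
have := @pairing_cvg _ _ 1 x (pairing_indicator_bound D).
move=> /(cvgrPdist_lt (V := R^o))/(_ e e0)[K _ /(_ K (leqnn K))] /=.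
rewrite -/(pairing _ x).
have -> : pairing (fun n => (D n)%:R) x =
    pairing (fun n => (D n && (K <= n)%N)%:R) x +
    pairing (fun n => (D n && (n < K)%N)%:R) x.
  rewrite -(@pairingDl _ _ _ 1) => [|n|n]; last 2 first.
  - by case: (D n && _); rewrite ?normr1 ?normr0.
  - by case: (D n && _); rewrite ?normr1 ?normr0.
  congr (pairing _ x); apply/funext => n.
  case: (D n) => //=; last by rewrite addr0.
  by case: leqP; rewrite ?addr0 ?add0r.
rewrite [X in _ + X - _](@pairing_eventually0 _ _ _ K) => [|n Kn]; last first.
  by rewrite ltnNge Kn andbF mul0r.
rewrite /series /= big_mkord.
rewrite [X in _ + X - _](eq_bigr (fun i : 'I_K => (D i)%:R * x i)).
  by rewrite addrK => ?; exists K.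
by move=> i _; rewrite ltn_ord andbT.
Qed.

End more_pairing.

(** * Points with two large coordinates of opposite signs *)

Section peaks.
Variable R : realType.
Implicit Types (x : ell1 R) (D : pred nat) (m n : nat).

(** In the unit ball this is the slice around the half difference of the unit
    vectors [m] and [n]. *)
Definition peaks m n x := (2 / 5 < x m) /\ (x n < - (2 / 5)).

Lemma peaks_other m n k x : `|x| <= 1 -> peaks m n x -> k != m -> k != n ->
  `|x k| < 5^-1.
Proof.
move=> x1 [xm xn] km kn.
have mn : m != n by apply/eqP => mn; rewrite mn in xm; lra.
(* The functional [x m - x n + `|x k|] is bounded by the norm. *)
pose w i : R := (i == m)%:R + (-1) * (i == n)%:R +
  Num.sg (x k) * (i == k)%:R.
have w1 i : `|w i| <= 1.
  rewrite /w; have [->|im] := eqVneq i m.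
    by rewrite (negbTE mn) eq_sym (negbTE km) !mulr0 !addr0 normr1.
  have [->|iN] := eqVneq i n.
    by rewrite eq_sym (negbTE kn) mulr0 add0r addr0 mulr1 normrN1.
  rewrite mulr0 !add0r normrM normr_sg.
  case: (i == k) => /=; last by rewrite normr0 mulr0.
  by rewrite normr1 mulr1; case: (_ != _).
have := pairing_le x w1.
have b1 := pairing_indicator_bound R (pred1 m).
have b2 (i : nat) : `|(i == m)%:R + (-1) * (i == n)%:R: R| <= 2.
  apply: (le_trans (ler_normD _ _)); have := b1 i => /=.
  rewrite mulN1r normrN.
  by case: (i == n) => /=; rewrite ?normr0 ?normr1 => ?; lra.
rewrite (@pairing_add_coord _ _ _ _ _ _ b2) (@pairing_add_coord _ _ _ _ _ _ b1).
rewrite /= pairing_coord.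
have -> : Num.sg (x k) * x k = `|x k| by rewrite -normrEsg.
move=> /(le_trans (ler_norm _)) ?; lra.
Qed.

Lemma peaks_dist m n k l x y : `|x| <= 1 -> `|y| <= 1 ->
  peaks m n x -> peaks k l y -> (m, n) != (k, l) -> 5^-1 <= `|x - y|.
Proof.
move=> x1 y1 pxy pkl.
have key j : `|x j - y j| <= `|x - y| by exact: (normr_le_ell1_norm (x - y)).
have [xm xn] := pxy; have [yk yl] := pkl.
rewrite xpair_eqE negb_and => /orP[mk|nl].
  apply: le_trans (key m); apply: le_trans (ler_norm _).
  have [ml|ml] := eqVneq m l; first by rewrite ml in xm *; lra.
  by have := peaks_other y1 pkl mk ml; rewrite ltr_norml => /andP[_ ?]; lra.
apply: le_trans (key n); rewrite -normrN; apply: le_trans (ler_norm _).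
have [nk|nk] := eqVneq n k; first by rewrite nk in xn *; lra.
by have := peaks_other y1 pkl nk nl; rewrite ltr_norml => /andP[? _]; lra.
Qed.

(** The sum over a set of indices that contains only the negative peak: the
    mass outside the two peaks is too small to compensate. *)
Lemma peaks_pairing D m n x : `|x| <= 1 -> peaks m n x -> D n -> ~~ D m ->
  pairing (fun i => (D i)%:R) x < - 5^-1.
Proof.
move=> x1 [xm xn] Dn Dm.
have mn : m != n by apply/eqP => mn; rewrite mn in xm; lra.
(* Adding [x m - 2 * x n] to the sum keeps all weights in [-1, 1]. *)
pose w i : R := (D i)%:R + 1 * (i == m)%:R + (-2) * (i == n)%:R.
have w1 i : `|w i| <= 1.
  rewrite /w mul1r; have [->|im] := eqVneq i m.
    by rewrite (negbTE Dm) (negbTE mn) add0r mulr0 addr0 normr1.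
  have [->|iN] := eqVneq i n; last first.
    by rewrite mulr0 !addr0; case: (D i); rewrite ?normr1 ?normr0.
  by rewrite Dn addr0 mulr1 (_ : 1%:R - 2 = -1 :> R) ?normrN1//; lra.
have := pairing_le x w1.
have b1 (i : nat) : `|(D i)%:R + 1 * (i == m)%:R : R| <= 2.
  apply: (le_trans (ler_normD _ _)); have := pairing_indicator_bound R D i.
  by rewrite mul1r; case: (i == m); rewrite ?normr0 ?normr1 => ?; lra.
rewrite (@pairing_add_coord _ _ _ _ _ _ b1).
rewrite (@pairing_add_coord _ _ _ _ _ _ (pairing_indicator_bound R D)).
move=> /(le_trans (ler_norm _)) ?; lra.
Qed.

End peaks.

(** * Extracting sparse pairs of indices *)

(** From infinitely many pairs [m < n] one extracts a sequence of pairs with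
    increasing second components, none of which is also a first component. *)
Lemma sparse_pairs (P : nat -> nat -> Prop) :
  (forall m n, P m n -> (m < n)%N) ->
  (forall N, exists m n, P m n /\ (N <= n)%N) ->
  exists s t : nat -> nat, [/\ forall i, P (s i) (t i),
    forall i j, (i < j)%N -> (t i < t j)%N & forall i j, s i != t j].
Proof.
move=> Plt Punb.
(* Either infinitely many pairs have a bounded first component, or the first
   component can be taken arbitrarily large. *)
have [M HM] : exists M, forall K, exists mn : nat * nat,
    [/\ P mn.1 mn.2, (K < mn.2)%N & (mn.1 <= M)%N \/ (K < mn.1)%N].
  have [[M HM]|noM] := pselect (exists M, forall K, exists m n,
      [/\ P m n, (K < n)%N & (m <= M)%N]).
    exists M => K; have [m [n [Pmn Kn mM]]] := HM K.
    by exists (m, n); split => //; left.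
  exists 0%N => K; apply: contra_notP noM => noK; exists K => K'.
  have [m [n [Pmn]]] := Punb (maxn K K').+1; rewrite gtn_max => /andP[Kn K'n].
  exists m, n; split => //; rewrite leqNgt; apply/negP => Km.
  by apply: noK; exists (m, n); split => //; right.
have [f fP] := choice HM.
pose p i := iter i (fun q => f q.2) (f M).
have pS i : p i.+1 = f (p i).2 by [].
have t_lt : {homo (fun i => (p i).2) : i j / (i < j)%N}.
  apply: homo_ltn => [? ? ?|i]; first exact: ltn_trans.
  by rewrite pS; case: (fP (p i).2).
have pP i : P (p i).1 (p i).2.
  by case: i => [|i]; [case: (fP M)|case: (fP (p i).2)].
have Mt i : (M < (p i).2)%N.
  elim: i => [|i IHi]; first by case: (fP M).
  by apply: ltn_trans IHi _; exact: t_lt.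
exists (fun i => (p i).1), (fun i => (p i).2); split => // i j.
apply/eqP => ij; have [ji|ij'] := ltnP j i; last first.
  have : ((p i).2 <= (p j).2)%N.
    by move: ij'; rewrite leq_eqVlt => /predU1P[->//|/t_lt/ltnW].
  by rewrite leqNgt -ij Plt.
case: i => // i in ij ji *; have [_ _] := fP (p i).2; rewrite -pS => -[|].
  by rewrite leqNgt ij Mt.
rewrite ij ltnNge => /negP; apply.
by move: ji; rewrite ltnS leq_eqVlt => /predU1P[->//|/t_lt/ltnW].
Qed.

(** * Half differences of unit vectors *)

Section half_difference.
Variable R : realType.
Implicit Types (w : nat -> R) (x : ell1 R) (M : R) (m n : nat).

Let delta_summable n : (fun j => (j == n)%:R : R^o) \in @abs_summable R.
Proof.
apply/asboolP.
apply: (is_cvg_near_cst (\sum_(0 <= i < n.+1) `|(i == n)%:R : R|)).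
exists n.+1 => // N /= nN; rewrite /series /= (@big_cat_nat _ _ _ n.+1)//=.
rewrite [X in _ + X]big_nat [X in _ + X]big1 ?addr0// => i /andP[ni _].
by rewrite gtn_eqF// normr0.
Qed.

(** The standard unit vectors of the space. *)
Definition unit_vector n : ell1 R := Ell1 (delta_summable n).

Lemma unit_vectorE n j : unit_vector n j = (j == n)%:R.
Proof. by []. Qed.

Lemma pairing_unit_vector w n : pairing w (unit_vector n) = w n.
Proof.
rewrite (@pairing_eventually0 _ _ _ n.+1) => [|j nj]; last first.
  by rewrite unit_vectorE gtn_eqF// mulr0.
rewrite big_ord_recr /= eqxx mulr1 big1 ?add0r// => i _.
by rewrite (ltn_eqF (ltn_ord i)) mulr0.
Qed.

Lemma unit_vector_norm n : `|unit_vector n| = 1.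
Proof.
rewrite -[RHS](pairing_unit_vector (fun=> 1) n) /pairing.
congr (limn (series _)); apply/funext => j; rewrite [RHS]mul1r.
by apply: ger0_norm; rewrite unit_vectorE.
Qed.

(** The vectors [(e_m - e_n) / 2], without any condition on [m] and [n]. *)
Definition half_diff m n : ell1 R := 2^-1 *: (unit_vector m - unit_vector n).

Lemma half_diffE m n j : half_diff m n j = ((j == m)%:R - (j == n)%:R) / 2.
Proof. by rewrite mulrC. Qed.

Lemma pairing_half_diff w M m n : (forall i, `|w i| <= M) ->
  pairing w (half_diff m n) = (w m - w n) / 2.
Proof.
move=> /pairing_dual[f fE]; rewrite -fE linearZ /= linearB /= !fE.
by rewrite !pairing_unit_vector [LHS]mulrC.
Qed.

Lemma half_diff_norm m n : m != n -> `|half_diff m n| = 1.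
Proof.
move=> mn; apply/eqP; rewrite eq_le; apply/andP; split.
  rewrite normrZ gtr0_norm// ler_pdivrMl// mulr1.
  by apply: (le_trans (ler_normB _ _)); rewrite !unit_vector_norm.
(* The weights -1 at [n] and 1 elsewhere attain the norm. *)
pose w i : R := if i == n then -1 else 1.
have w1 i : `|w i| <= 1 by rewrite /w; case: eqP; rewrite ?normrN1 ?normr1.
have := pairing_le (half_diff m n) w1; rewrite (pairing_half_diff _ _ w1).
rewrite /w eqxx (negbTE mn) mul1r => /(le_trans (ler_norm _)) => h.
by apply: le_trans h; lra.
Qed.

Lemma half_diff_peaks m n : m != n -> peaks m n (half_diff m n).
Proof.
move=> mn; rewrite /peaks !half_diffE !eqxx (negbTE mn) eq_sym (negbTE mn) /=.
split; lra.
Qed.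

Lemma half_diff_neq0 m n : m != n -> half_diff m n != 0.
Proof. by move=> /half_diff_norm h; rewrite -normr_gt0 h. Qed.

End half_difference.

(** * Weak cluster points of the half differences *)

Section weak_topology_ell1.
Variable R : realType.
Implicit Types (x : ell1 R) (m n : nat).
Local Notation wE := (weak (ell1 R)).

Lemma dual_unit_vector_bounded (f : dual (ell1 R)) :
  exists C, forall n, `|sval f (unit_vector R n)| <= C.
Proof.
have /linear_bounded_continuous/linear_boundedP := svalP f.
move=> /pinfty_ex_gt0[C _ fC]; exists C => n.
by have := fC (unit_vector R n); rewrite unit_vector_norm mulr1.
Qed.

Lemma ultrafilter_dual_cvg (U : set_system nat) (f : dual (ell1 R)) :
  UltraFilter U -> exists l : R, forall e : R, 0 < e ->
  U [set n | `|l - sval f (unit_vector R n)| < e].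
Proof.
move=> UU; have PU := @ultra_proper _ _ UU.
have [C fC] := dual_unit_vector_bounded f.
pose g n : R := sval f (unit_vector R n).
have gC : U (g @^-1` `[- C, C]%classic).
  apply: (filterS _ filterT) => n _; rewrite /= in_itv/= -ler_norml.
  exact: fC.
have [l [_ ul]] := @segment_compact R (- C) C (fmap g U) _ gC.
exists l => e e0; have [//|Un] := in_ultra_setVsetC [set n | `|l - g n| < e] UU.
have gU : U (g @^-1` (g @` ~` [set n | `|l - g n| < e])).
  by apply: (filterS _ Un) => n /= ?; exists n.
by have [_ [[n /= ln <-] /ln]] := ul _ (ball l e) gU (nbhsx_ballx _ _ e0).
Qed.

(** Every weak neighbourhood of 0 contains half differences with an arbitrarily
    large second index. *)
Lemma half_diff_cluster0 (W : set wE) N : nbhs (0 : wE) W ->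
  exists m n, [/\ (m < n)%N, (N <= n)%N & W (half_diff R m n)].
Proof.
have [U [UU Uoo]] := ultraFilterLemma eventually_filter.
have PU := @ultra_proper _ _ UU.
(* The iterated filter: for U-almost all [m], for U-almost all [n]. *)
pose G : set_system (nat * nat) :=
  fun S => U (fun m => U (fun n => S (m, n))).
have PG : ProperFilter G.
  split; first (move=> S0; have [m] := filter_ex (S0 : U _);
    exact: filter_not_empty).
  split.
  - by apply: (@filterS _ U _ setT) filterT => m _; exact: filterT.
  - by move=> S T GS GT; apply: (@filterS2 _ U _) GS GT => m; exact: filterI.
  - move=> S T ST; apply: (@filterS _ U _) => m; apply: (@filterS _ U _) => n.
    exact: ST.
have G0 : (fun mn => half_diff R mn.1 mn.2 : wE) @ G --> (0 : wE).
  apply/cvg_sup => f A [_ [[B Bop <-] B0 BA]].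
  have /nbhs_ballP[e e0 eB] : nbhs (0 : R^o) B.
    by apply: open_nbhs_nbhs; split => //; move: B0; rewrite /= linear0.
  have [l fl] := ultrafilter_dual_cvg f UU.
  have fle := fl e e0.
  apply: (@filterS _ U _) fle => m ml.
  apply: (@filterS _ U _) (fl e e0) => n nl.
  apply: BA; apply: eB => /=; rewrite -ball_normE/= sub0r normrN.
  rewrite linearZ linearB/= [X in `|X|](_ : _ =
    2^-1 * (sval f (unit_vector R m) - l) +
    2^-1 * (l - sval f (unit_vector R n))); last first.
    by rewrite -mulrDr subrKA.
  apply: (le_lt_trans (ler_normD _ _)); rewrite !normrM distrC gtr0_norm//.
  by move: ml nl => /=; lra.
move=> /G0 GW0; have GW : G [set mn | W (half_diff R mn.1 mn.2)] := GW0.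
have GN : G [set mn | (maxn N mn.1.+1 <= mn.2)%N].
  apply: (@filterS _ U _ setT) filterT => m _; apply: Uoo.
  by exists (maxn N m.+1).
have [[m n] [/= Wmn]] := filter_ex (@filterI _ G _ _ _ GW GN).
by rewrite geq_max => /andP[? ?]; exists m, n.
Qed.

Lemma open_neq0_weak (f : wE -> R) (z : wE) : continuous f -> f z != 0 ->
  nbhs z [set x | f x != 0].
Proof.
move=> fc fz; apply: (fc z [set r | r != 0]).
by apply: open_nbhs_nbhs; split => //; exact: open_neq.
Qed.

(** A nonzero [z] has a weak neighbourhood containing no half difference other
    than possibly [z] itself. *)
Lemma half_diff_isolated (z : ell1 R) : z != 0 ->
  exists2 W : set wE, nbhs (z : wE) W &
  forall m n, (m < n)%N -> W (half_diff R m n) -> half_diff R m n = z.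
Proof.
move=> z0; have b1 (i : nat) : `|1 : R| <= 1 by rewrite normr1.
have [s0|s0] := eqVneq (pairing (fun=> 1) z) 0; last first.
  exists [set x | pairing (fun=> 1) x != 0].
    apply: (@open_neq0_weak (pairing (fun=> 1))) => //.
    exact: pairing_weak_continuous b1.
  by move=> m n _; rewrite /= (pairing_half_diff _ _ b1) subrr mul0r eqxx.
have [p [q [pq zp zq]]] : exists p q, [/\ (p < q)%N, z p != 0 & z q != 0].
  apply: contrapT => H.
  have [p zp] : exists p, z p != 0.
    apply/not_existsP => zN; move/eqP: z0; apply; apply/val_inj/funext => p.
    by apply/eqP; apply: contra_notT (zN p).
  have zN q : q != p -> z q = 0.
    rewrite neq_ltn => /orP[qp|pq]; apply/eqP; apply/negP => /negP zq;
      apply: H.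
      by exists q, p.
    by exists p, q.
  move/eqP: zp; apply; rewrite -[RHS]s0.
  rewrite (@pairing_eventually0 _ _ _ p.+1) => [|n pn]; last first.
    by rewrite mul1r zN// gtn_eqF.
  rewrite big_ord_recr big1 /= ?add0r ?mul1r// => i _.
  by rewrite zN ?mulr0// ltn_eqF.
have pN : nbhs (z : wE) [set x : wE | (x : ell1 R) p != 0].
  apply: (@open_neq0_weak (fun x : ell1 R => x p)) => //.
  exact: coord_weak_continuous.
have qN : nbhs (z : wE) [set x : wE | (x : ell1 R) q != 0].
  apply: (@open_neq0_weak (fun x : ell1 R => x q)) => //.
  exact: coord_weak_continuous.
(* Only the pair [(p, q)] remains; its half difference is excluded when it
   differs from [z]. *)
have [W3 W3z W3h] : exists2 W : set wE, nbhs (z : wE) W &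
    W (half_diff R p q) -> half_diff R p q = z.
  have [hz|/eqP hz] := eqVneq (half_diff R p q) z.
    by exists setT => //; exact: filterT.
  have [j hj] : exists j, z j != half_diff R p q j.
    apply/not_existsP => zN; apply: hz; apply/val_inj/funext => j.
    by apply/eqP; rewrite eq_sym; apply: contra_notT (zN j).
  exists [set x : wE | (x : ell1 R) j != half_diff R p q j].
    apply: (@coord_weak_continuous R j z [set r | r != half_diff R p q j]).
    by apply: open_nbhs_nbhs; split => //; exact: open_neq.
  by rewrite /= eqxx.
exists ([set x : wE | (x : ell1 R) p != 0] `&`
    [set x : wE | (x : ell1 R) q != 0] `&` W3).
  by apply: filterI => //; exact: filterI.
move=> m n mn [[/= hp hq]].
have [-> ->] : m = p /\ n = q; last exact: W3h.
have E j : half_diff R m n j != 0 -> j = m \/ j = n.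
  rewrite half_diffE; have [->|_] := eqVneq j m; first by left.
  by have [->|_] := eqVneq j n; [right|rewrite subrr mul0r eqxx].
have [pm|pn] := E p hp; have [qm|qn] := E q hq; subst => //; lia.
Qed.

End weak_topology_ell1.

(** * Weakly compact sets and weakly Cauchy sequences *)

Section weak_compactness.
Variable R : realType.
Implicit Types (x : ell1 R) (m n : nat).
Local Notation wE := (weak (ell1 R)).

(** A weakly compact subset of the unit ball meets only finitely many slices. *)
Lemma weak_compact_peaks (C : set wE) :
  (forall x : ell1 R, C x -> `|x| <= 1) -> compact C ->
  exists N, forall m n (x : ell1 R),
    (m < n)%N -> C x -> peaks m n x -> (n < N)%N.
Proof.
move=> C1 Cc; apply: contrapT => noN.
pose P m n := (m < n)%N /\ exists x : ell1 R, C x /\ peaks m n x.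
have [|N|s [t [Pst tlt st]]] := @sparse_pairs P; first by move=> m n [].
  apply: contrapT => noP; apply: noN; exists N => m n x mn Cx px.
  rewrite ltnNge; apply/negP => Nn; apply: noP; exists m, n.
  by split => //; split => //; exists x.
have [y yP] := choice (fun i => (Pst i).2).
have it i : (i <= t i)%N.
  by elim: i => // i /leq_ltn_trans; apply; exact: tlt.
have yC : (y @ \oo) C by exists 0%N => // i _; case: (yP i).
have [z [Cz zy]] := Cc _ _ yC.
pose D n := `[< exists i, t i = n >].
have [K zK] : exists K, `|pairing (fun n => (D n && (K <= n)%N)%:R) z| < 5^-1.
  by apply: pairing_tail; rewrite invr_gt0.
have Kb := @pairing_indicator_bound R (fun n => D n && (K <= n)%N).
have yK : (y @ \oo) [set x : wE |
    pairing (fun n => (D n && (K <= n)%N)%:R) x < - 5^-1].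
  exists K => // i /= Ki; have [yiC yip] := yP i.
  apply: (peaks_pairing (C1 _ yiC) yip (D := fun n => D n && (K <= n)%N)).
    by rewrite (leq_trans Ki (it i)) andbT; apply/asboolP; exists i.
  rewrite negb_and; apply/orP; left; apply/asboolPn => -[j /eqP].
  by rewrite eq_sym (negbTE (st i j)).
have zK' : nbhs (z : wE) [set x : wE |
    - 5^-1 < pairing (fun n => (D n && (K <= n)%N)%:R) x].
  apply: (@pairing_weak_continuous R _ 1 Kb z [set r | - 5^-1 < r]).
  by apply: lt_nbhsr; move: zK; rewrite ltr_norml => /andP[].
have [x [/= xl xg]] := zy _ _ yK zK'.
by have := lt_trans xl xg; rewrite ltxx.
Qed.

Lemma weak_cauchy_pairing (x : nat -> wE) w (M e : R) :
  (forall n, `|w n| <= M) -> cauchy (x @ \oo) -> 0 < e ->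
  exists N, forall i j, (N <= i)%N -> (N <= j)%N ->
    `|pairing w (x i) - pairing w (x j)| < e.
Proof.
move=> wM xc e0; have [f fE] := pairing_dual wM.
pose V : set (wE * wE) := [set p | `|sval f p.1 - sval f p.2| < e].
have entV : entourage V.
  pose V0 : set (ell1 R * ell1 R) := V.
  have ent0 : @entourage (initial_topology (sval f : ell1 R -> R^o)) V0.
    exists [set p : R^o * R^o | ball p.1 e p.2]; last by [].
    exact: (@entourage_ball R R^o (PosNum e0)).
  have sub : `[< @entourage (initial_topology (sval f : ell1 R -> R^o)) V0 >].
    exact/asboolP.
  exists V => //.
  pose ent_of (p : {classic dual (ell1 R)} * set (ell1 R * ell1 R)) :=
    `[< @entourage (initial_topology (sval p.1 : ell1 R -> R^o)) p.2 >].
  pose p0 : {p | ent_of p} := exist _ (f, V0) sub.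
  exact: (@finI_from1 _ _ setT (fun p : {p | ent_of p} => (projT1 p).2) p0).
have [[A B] /= [xA xB] ABV] := xc _ entV.
have [N _ NAB] := filterI xA xB.
exists N => i j Ni Nj; rewrite -!fE.
by apply: (ABV (x i, x j)); split; [case: (NAB i Ni)|case: (NAB j Nj)].
Qed.

Lemma half_diff_gt0 m n k : 0 < half_diff R m n k -> k = m.
Proof.
rewrite half_diffE; have [//|_] := eqVneq k m.
by case: (k == n) => /= h; exfalso; lra.
Qed.

Lemma half_diff_lt0 m n k : half_diff R m n k < 0 -> k = n.
Proof.
rewrite half_diffE; have [//|_] := eqVneq k n.
by case: (k == m) => /= h; exfalso; lra.
Qed.

Let close_gt0 (a b : R) : 2 / 5 < a -> `|a - b| < 4^-1 -> 0 < b.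
Proof. by rewrite ltr_norml => a0 /andP[ab ba]; lra. Qed.

Let close_lt0 (a b : R) : a < - (2 / 5) -> `|a - b| < 4^-1 -> b < 0.
Proof. by rewrite ltr_norml => a0 /andP[ab ba]; lra. Qed.

Lemma weak_cauchy_half_diff (x : nat -> ell1 R) :
  (forall i, exists m n, (m < n)%N /\ x i = half_diff R m n) ->
  cauchy ((x : nat -> wE) @ \oo) -> trivial_seq x.
Proof.
move=> xA xc.
have /choice[p pP] i : exists q : nat * nat,
    (q.1 < q.2)%N /\ x i = half_diff R q.1 q.2.
  by have [m [n mn]] := xA i; exists (m, n).
have [[N pN]|noN] := pselect (exists N, forall i, ((p i).2 < N)%N).
  (* The terms then have only finitely many coordinates that may be nonzero,
     and these stabilize because they take isolated values. *)
  have [I HI] : exists I, forall q i j, (q < N)%N -> (I <= i)%N -> (I <= j)%N ->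
      `|x i q - x j q| < 4^-1.
    elim: {pN}N => [|N [I HI]]; first by exists 0%N.
    have [//|J HJ] := @weak_cauchy_pairing x _ 1 4^-1
      (pairing_indicator_bound R (pred1 N)) xc.
    exists (maxn I J) => q i j; rewrite ltnS !geq_max leq_eqVlt.
    move=> /predU1P[->|qN] /andP[Ii Ji] /andP[Ij Jj]; last exact: HI.
    by have := HJ i j Ji Jj; rewrite /= !pairing_coord.
  exists I => i /ltnW Ii; have [mn xi] := pP i; have [kl xI] := pP I.
  have [xm xn] := half_diff_peaks R (negbT (ltn_eqF mn)).
  rewrite -xi in xm xn.
  have := close_gt0 xm (HI _ _ _ (ltn_trans mn (pN i)) Ii (leqnn I)).
  have := close_lt0 xn (HI _ _ _ (pN i) Ii (leqnn I)).
  by rewrite xi xI => /half_diff_lt0 -> /half_diff_gt0 ->.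
pose P m n := exists i, p i = (m, n).
have [|K|s [t [Pst tlt st]]] := @sparse_pairs P.
- by move=> m n [i pi]; have := (pP i).1; rewrite pi.
- apply: contrapT => noP; apply: noN; exists K => i.
  rewrite ltnNge; apply/negP => Ki; apply: noP; exists (p i).1, (p i).2.
  by split => //; exists i; case: (p i).
have jt j : (j <= t j)%N.
  by elim: j => // j /leq_ltn_trans; apply; exact: tlt.
have t_inj i j : t i = t j -> i = j.
  by move=> tij; case: (ltngtP i j) => // /tlt; rewrite tij ltnn.
(* Only every other second index is selected, so that the functional takes
   two values along the sequence. *)
pose D n := `[< exists i, t i.*2 = n >].
have [//|N HN] := @weak_cauchy_pairing x _ 1 4^-1
  (pairing_indicator_bound R D) xc.
(* Pairs of rank at least [J] are not reached before the index [N]. *)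
pose J := (\max_(i < N) (p i).2).+1.
have Jlate j i : (J <= j)%N -> p i = (s j, t j) -> (N <= i)%N.
  move=> Jj pij; rewrite leqNgt; apply/negP => iN.
  have := leq_trans Jj (jt j); rewrite /J ltnNge => /negP; apply.
  have := leq_bigmax (F := fun i : 'I_N => (p i).2) (Ordinal iN).
  by rewrite /= pij.
have Ds j : D (s j) = false.
  by apply/asboolPn => -[i /eqP]; rewrite eq_sym (negbTE (st j i.*2)).
have [i pi] := Pst J.*2; have [k pk] := Pst J.*2.+1.
have JJ : (J <= J.*2)%N by rewrite -addnn leq_addr.
have := HN i k (Jlate _ _ JJ pi) (Jlate _ _ (leqW JJ) pk).
rewrite (pP i).2 (pP k).2 pi pk /=.
rewrite !(pairing_half_diff _ _ (pairing_indicator_bound R D)).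
have De : D (t J.*2) by apply/asboolP; exists J.
have Do : D (t J.*2.+1) = false.
  by apply/asboolPn => -[j /t_inj /(congr1 odd)]; rewrite /= !odd_double.
rewrite !Ds De Do /= ltr_norml => /andP[+ _].
by clear => h; lra.
Qed.

End weak_compactness.

(** * Failure of the Ascoli property *)

Section not_ascoli.
Import ArrowAsCompactOpen.
Variable R : realType.
Local Notation wE := (weak (ell1 R)).
Implicit Types (m n : nat) (Z : set wE).

(** A weakly continuous function that vanishes off the slice of [m] and [n]; the
    factor 10 gives it the value 1 at the half difference. *)
Definition bump m n (x : wE) : R :=
  10 * maxr 0 (minr ((x : ell1 R) m) (- (x : ell1 R) n) - 2 / 5).

Lemma bump_half_diff m n : m != n -> bump m n (half_diff R m n) = 1.
Proof.
move=> mn; rewrite /bump !half_diffE !eqxx (negbTE mn) eq_sym (negbTE mn) /=.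
rewrite subr0 sub0r mulNr opprK mul1r minxx max_r; lra.
Qed.

Lemma bump_eq0 m n (x : ell1 R) : ~ peaks m n x -> bump m n x = 0.
Proof.
move=> px; apply/eqP; rewrite mulf_eq0; apply/orP; right; apply/eqP.
apply: max_l; rewrite subr_le0 leNgt lt_min; apply/negP => /andP[xm xn].
by apply: px; split => //; rewrite ltrNr.
Qed.

Lemma bump_continuous m n : continuous (bump m n).
Proof.
move=> x; apply: (@continuousM R wE); first exact: cst_continuous.
apply: (@continuous_max R wE); first exact: cst_continuous.
apply: (@continuousB _ R^o wE); last exact: cst_continuous.
apply: (@continuous_min R wE); first exact: coord_weak_continuous.
apply: (@continuousN _ R^o wE); exact: coord_weak_continuous.
Qed.

Lemma bump_set_val_continuous Z m n :
  continuous (bump m n \o set_val : Z -> R).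
Proof.
move=> x; apply: continuous_comp; first exact: initial_continuous.
exact: bump_continuous.
Qed.

(** The bump functions restricted to a subset, as points of the space of
    continuous functions; likewise for the zero function. *)
Definition bump_on Z m n : continuousType Z R :=
  mkcts (@bump_set_val_continuous Z m n).

Definition zero_on Z : continuousType Z R :=
  mkcts (@cst_continuous Z R 0).

(** Convergence to 0 in the compact-open topology as [n] tends to infinity,
    uniformly in [m < n]. *)
Lemma bump_on_cvg0 Z (N : set (continuousType Z R)) :
  (forall x : ell1 R, Z x -> `|x| <= 1) -> nbhs (zero_on Z) N ->
  exists K, forall m n, (m < n)%N -> (K <= n)%N -> N (bump_on Z m n).
Proof.
move=> Z1 [_ [[B Bop <-] B0 BN]].
pose G : set_system (nat * nat) := fun S =>
  exists K, forall m n, (m < n)%N -> (K <= n)%N -> S (m, n).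
have FG : Filter G.
  split.
  - by exists 0%N.
  - move=> S T [K KS] [L LT]; exists (maxn K L) => m n mn.
    by rewrite geq_max => /andP[Kn Ln]; split; [exact: KS|exact: LT].
  - by move=> S T ST [K KS]; exists K => m n mn Kn; apply/ST/KS.
have cv : ((fun mn => bump_on Z mn.1 mn.2 : {compact-open, Z -> R}) @ G) -->
    (zero_on Z : {compact-open, Z -> R}).
  apply/compact_open_cvgP => C O Cc Oop zO.
  have [||K HK] := @weak_compact_peaks R (set_val @` C).
  - by move=> x [y Cy <-]; apply: Z1; exact: set_valP.
  - apply: continuous_compact => //; apply: continuous_subspaceT.
    exact: initial_continuous.
  exists K => m n mn Kn _ [y Cy <-].
  apply: zO; exists y => //; rewrite [RHS]bump_eq0// => py.
  have := HK m n (set_val y) mn (ex_intro2 _ _ y Cy erefl) py.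
  by rewrite ltnNge Kn.
have [K HK] : G [set mn | B (bump_on Z mn.1 mn.2)].
  by apply: cv; apply: open_nbhs_nbhs.
by exists K => m n mn Kn; apply: BN; exact: HK.
Qed.

Lemma bump_on_compact Z : (forall x : ell1 R, Z x -> `|x| <= 1) ->
  compact [set f : continuousType Z R | f = zero_on Z \/
    exists m n, (m < n)%N /\ f = bump_on Z m n].
Proof.
set K := [set f | _] => Z1 F PF FK.
(* If 0 is not a cluster point, the filter lives on finitely many bumps. *)
have [zF|] := pselect (cluster F (zero_on Z)).
  by exists (zero_on Z); split => //; left.
move=> /existsNP[A /existsNP[N /not_implyP[FA /not_implyP[nN AN]]]].
have [M MN] := bump_on_cvg0 Z1 nN.
pose L := [set bump_on Z mn.1 mn.2 | mn in [set mn : nat * nat |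
  (mn.1 < mn.2)%N /\ (mn.2 < M)%N]].
have Lfin : finite_set L.
  apply: finite_image; apply: (@sub_finite_set _ _ (`I_M `*` `I_M)).
    by move=> [m n] /= [mn nM]; split => //=; exact: ltn_trans nM.
  by apply: finite_setX; exact: finite_II.
have FL : F L.
  apply: filterS (filterI FA FK) => f [Af [f0|[m [n [mn fmn]]]]].
    exfalso; apply: AN; exists f; split => //.
    by rewrite f0; exact: nbhs_singleton.
  exists (m, n) => //; split => //=; rewrite ltnNge; apply/negP => Mn.
  apply: AN; exists f; split => //; rewrite fmn; exact: MN.
have [f [[[m n] /= [mn _] <-] Ff]] := finite_compact Lfin PF FL.
by exists (bump_on Z m n); split => //; right; exists m, n.
Qed.

(** The bump functions and 0 form a compact set that is not evenly continuous
    at the function 0 and the point 0. *)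
Lemma not_ascoli_half_diff Z : (forall x : ell1 R, Z x -> `|x| <= 1) ->
  Z (0 : ell1 R) -> (forall m n, (m < n)%N -> Z (half_diff R m n)) ->
  ~ ascoli_space R Z.
Proof.
move=> Z1 Z0 Zh [_ /(_ _ (bump_on_compact Z1)) ec].
set K := [set f | _] in ec.
pose z0 : Z := SigSub (mem_set Z0).
have := ec (zero_on Z, z0) (ball (0 : R) 1) (nbhsx_ballx _ _ ltr01).
rewrite /nbhs /= -nbhs_subspace_in; last by split => //; left.
move=> [[N W] /= [nN [_ [[W' W'op <-] W'0 W'W]]] NW].
have [M MN] := bump_on_cvg0 Z1 nN.
have [m [n [mn Mn W'mn]]] : exists m n,
    [/\ (m < n)%N, (M <= n)%N & W' (half_diff R m n)].
  by apply: half_diff_cluster0; apply: open_nbhs_nbhs.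
pose y : Z := SigSub (mem_set (Zh m n mn)).
have Ky : (K `*` [set: Z]) (bump_on Z m n, y).
  by split => //; right; exists m, n.
have : ball (0 : R) 1 (bump m n (half_diff R m n)) :=
  NW (bump_on Z m n, y) (conj (MN m n mn Mn) (W'W y W'mn)) Ky.
rewrite (bump_half_diff (negbT (ltn_eqF mn))) -ball_normE /= sub0r normrN.
by rewrite normr1 ltxx.
Qed.

End not_ascoli.

(** * The announced set and neighbourhoods *)

Lemma half_diff_equiv_ell1_basis (R : realType) :
  equiv_ell1_basis (fun n => half_diff R 0 n.+1).
Proof.
split=> [n|]; first exact: half_diff_norm.
exists 2^-1 => // n c.
(* The weights are chosen to turn each term of the sum into |c i| / 2. *)
pose w k : R := if k is k'.+1 then - Num.sg (c k') else 0.
have w1 k : `|w k| <= 1.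
  case: k => [|k] /=; first by rewrite normr0.
  by rewrite normrN normr_sg; case: (_ != _).
have := pairing_le (\sum_(i < n) c i *: half_diff R 0 i.+1) w1.
rewrite mul1r => /(le_trans (ler_norm _)); apply: le_trans.
have [f fE] := pairing_dual w1.
rewrite -fE linear_sum mulr_sumr; apply: ler_sum => i _.
rewrite linearZ /= fE (pairing_half_diff _ _ w1) /= sub0r opprK.
by rewrite [leRHS]mulrA [c i * _]mulrC -normrEsg mulrC.
Qed.

Theorem proposition4p1 (R : realType) :
  let E : normedModType R := ell1 R in
  let B : set E := [set x | `|x| <= 1] in
  let Bw : topologicalType := set_type (B : set (weak E)) in
  exists (A : set E) (U : E -> set E),
    let clA : set (weak E) := closure (A : set (weak E)) in
    [/\ countable A,
        A `<=` [set x | `|x| = 1] &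
        forall a, A a -> U a `<=` B /\ open (set_val @^-1` U a : set Bw)] /\
    [/\ (* (1) *) forall a, A a -> U a a,
        (* (2) *) forall a b, A a -> A b -> a <> b ->
          ((5^-1)%:E <= set_dist (U a) (U b))%E,
        (* (3) *) limit_point (A : set (weak E)) = [set 0] &
        (* (4) *) forall C : set E, C `<=` B -> compact (C : set (weak E)) ->
          finite_set [set a | A a /\ C `&` U a !=set0]] /\
    [/\ (* (5) *) clA = A `|` [set 0] /\
          (forall C : set (weak E), C `<=` clA -> compact C -> finite_set C),
        (* (6) *) exists x : nat -> E, (forall n, A (x n)) /\ equiv_ell1_basis x,
        (* (7) *) forall x : nat -> E, (forall n, A (x n)) ->
          cauchy ((x : nat -> weak E) @ \oo) -> trivial_seq x &
        (* (8) *) [/\ countable clA, ~ ascoli_space R clA & ~ ascoli_space R Bw]].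
Proof.
move=> E B Bw.
pose P := [set mn : nat * nat | (mn.1 < mn.2)%N].
pose h (mn : nat * nat) : E := half_diff R mn.1 mn.2.
pose A : set E := h @` P.
(* [U a] is the slice of [a], written without choosing the pair of [a]. *)
pose U (a : E) : set E := [set x | `|x| <= 1 /\
  exists m n, [/\ (m < n)%N, a = half_diff R m n & peaks m n x]].
have hA m n : (m < n)%N -> A (half_diff R m n) by move=> mn; exists (m, n).
have A1 : A `<=` [set x | `|x| = 1].
  by move=> _ [[m n] /= mn <-]; apply: half_diff_norm; rewrite ltn_eqF.
have Acountable : countable A.
  by apply: (sub_countable (card_image_le _ _)); exact: countableP.
have limA : limit_point (A : set (weak E)) = [set 0].
  apply/seteqP; split => [z zA|_ -> W /(half_diff_cluster0 0)].
    apply: contrapT => /eqP/half_diff_isolated.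
    move=> [W /zA[y [yz [[m n] mn hy] Wy]] WN].
    by move/eqP: yz; apply; rewrite -hy; apply: WN => //; rewrite -hy in Wy.
  move=> [m [n [mn _ Wh]]]; exists (half_diff R m n).
  split => //; last exact: hA.
  by apply: half_diff_neq0; rewrite ltn_eqF.
have clAE : closure (A : set (weak E)) = A `|` [set 0].
  apply/seteqP; split => [x|x].
    rewrite closure_isolated_limit_point limA => -[/isolatedS|]; first by left.
    by right.
  move=> [/subset_closure//|x0]; apply: subset_limit_point.
  by rewrite limA.
have cptA (C : set E) : C `<=` B -> compact (C : set (weak E)) ->
    finite_set [set a | A a /\ C `&` U a !=set0].
  move=> CB Cc; have [N HN] := weak_compact_peaks CB Cc.
  apply: (@sub_finite_set _ _ (h @` (`I_N `*` `I_N))).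
    move=> _ /= [_ [x [Cx [_ [m [n [mn -> px]]]]]]].
    have nN := HN m n x mn Cx px.
    by exists (m, n) => //; split => //=; exact: ltn_trans nN.
  by apply: finite_image; apply: finite_setX; exact: finite_II.
have clAB : closure (A : set (weak E)) `<=` B.
  by rewrite clAE => x [/A1 /= xE|->]; rewrite /B /= ?xE ?normr0.
have UA a : A a -> U a a.
  move=> Aa; split; first by rewrite (A1 _ Aa).
  case: Aa => [[m n] /= mn <-]; exists m, n; split => //.
  by apply: half_diff_peaks; rewrite ltn_eqF.
exists A, U => clA; split.
  split => // a Aa; split; first by move=> x [].
  exists (\bigcup_(mn in [set mn : nat * nat | P mn /\ a = h mn])
    ([set x : weak E | 2 / 5 < (x : ell1 R) mn.1] `&`
     [set x : weak E | (x : ell1 R) mn.2 < - (2 / 5)])).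
    apply: bigcup_open => -[m n] _; apply: openI.
      apply: (open_comp (f := fun x : weak E => (x : ell1 R) m)
        (D := [set r | 2 / 5 < r])); last exact: open_gt.
      by move=> x _; exact: coord_weak_continuous.
    apply: (open_comp (f := fun x : weak E => (x : ell1 R) n)
      (D := [set r | r < - (2 / 5)])); last exact: open_lt.
    by move=> x _; exact: coord_weak_continuous.
  apply/seteqP; split => x /=.
    move=> [[m n] [/= mn aE] [xm xn]]; split; first exact: (set_valP x).
    by exists m, n.
  by move=> [_ [m [n [mn aE [xm xn]]]]]; exists (m, n).
split; first split.
- exact: UA.
- move=> a b _ _ ab; apply: le_ereal_inf_tmp =>
    _ [x [x1 [m [n [mn aE px]]]] [y [y1 [k [l [kl bE py]]]] <-]].
  rewrite lee_fin; apply: (peaks_dist x1 y1 px py).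
  by apply/eqP => -[mk nl]; apply: ab; rewrite aE bE mk nl.
- exact: limA.
- exact: cptA.
split.
- split; first exact: clAE.
  move=> C CA Cc; apply: (@sub_finite_set _ _ ([set 0] `|`
      [set a | A a /\ (C : set E) `&` U a !=set0])).
    move=> x Cx; have := CA x Cx; rewrite /clA clAE => -[Ax|->]; last by left.
    by right; split => //; exists x; split => //; exact: UA.
  rewrite finite_setU; split; first exact: finite_set1.
  by apply: cptA => // x /CA /clAB.
- exists (fun n => half_diff R 0 n.+1).
  split; last exact: half_diff_equiv_ell1_basis.
  by move=> n; exact: hA.
- move=> x xA; apply: weak_cauchy_half_diff => i.
  by have [[m n] /= mn <-] := xA i; exists m, n.
- split.
  + rewrite /clA clAE -bigcup2E.
    apply: bigcup_countable; first exact: countableP.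
    move=> [|[|i]] _ /=; first exact: Acountable.
      exact: countable1.
    exact: countable0.
  + apply: not_ascoli_half_diff; first exact: clAB.
      by rewrite /clA clAE; right.
    by move=> m n mn; apply: subset_closure; exact: hA.
  + apply: not_ascoli_half_diff => //; first by rewrite /B /= normr0.
    by move=> m n /hA /A1 /= hE; rewrite /B /= hE.
Qed.
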